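(* If $Y$ is a compact Hausdorff space with more than one point and $I$ is a set of cardinality at least $\mathbf c$, the cardinality of the continuum, then the compact product space $Y^I$ does not admit any topological tournament.
   Context: A tournament on a nonempty set $X$ is a relation $R\subset X\times X$ with $R\cap R^{-1}=\{(x,x):x\in X\}$ and $R\cup R^{-1}=X\times X$. It is a topological tournament on a topological space $X$ when $R$ is closed in $X\times X$. *)

(* Defs.v *)
From mathcomp Require Import all_boot all_order all_algebra.
From mathcomp Require Import all_classical all_reals all_analysis.

Set Implicit Arguments.
Unset Strict Implicit.
Unset Printing Implicit Defensive.

Local Open Scope classical_set_scope.

Definition tournament (X : Type) (T : set (X * X)) : Prop :=
  [/\ [set: X] !=set0,
      T `&` T^-1%relation = diagonal &
      T `|` T^-1%relation = [set: X * X]].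

Definition topological_tournament (X : topologicalType) (T : set (X * X)) :
    Prop :=
  tournament T /\ closed T.

(* Main.v *)
Require Import Defs.
From mathcomp Require Import all_boot all_order all_algebra.
From mathcomp Require Import all_classical all_reals all_analysis.

(** Let [e i] be the point of [Y ^ I] whose coordinates all equal [y1], except
    the [i]-th one, which is [y2 <> y1].  Any basic neighbourhood of the
    constant point [y1] constrains finitely many coordinates only, so it
    contains all but finitely many [e i]: the points [e i] converge to a limit
    different from each of them, along the cofinite filter of [I]
    ([cvg_change_coordinate]).  In other words, [Y ^ I] contains the one-point
    compactification of the discrete space [I].

    In a topological tournament such a family has to be countable
    ([tournament_cvg_cofinite_countable]).  By antisymmetry each [e i] is
    strictly on one side of the limit, and since strict comparison is open,
    [e i] is then strictly on that same side of all but finitely many [e j].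
    Uncountably many indices cannot all behave in this way for the same side
    ([asymmetric_cofinite_countable]): infinitely many of them, countably
    chosen, leave out only countably many points altogether, so they are all
    strictly on that side of some further index [d] of the same kind, yet [d]
    is strictly on that side of all but finitely many of them.

    As [I] has at least the cardinality of the continuum, it is uncountable. *)

Set Implicit Arguments.
Unset Strict Implicit.
Unset Printing Implicit Defensive.

Local Open Scope classical_set_scope.
Local Open Scope card_scope.

(** An uncountable [D] would contain an infinite countable [C], and the elements
    of [I] that some element of [C] fails to dominate would be countably many.
    Any other [d] in [D] is dominated by the whole of [C], so it dominates
    nothing in [C], although it has only finitely many exceptions. *)
Lemma asymmetric_cofinite_countable {I : Type} (S : I -> I -> Prop)
    (D : set I) :
  (forall i j, S i j -> ~ S j i) ->
  (forall i, D i -> finite_set [set j | ~ S i j]) -> countable D.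
Proof.
move=> asymS cofS; apply: contrapT => uncD.
have infD : infinite_set D by move=> /finite_set_countable.
have /infiniteP/card_subP[C eqC CD] := infD.
have cntC : countable C by rewrite (eq_countable eqC).
have infC : infinite_set C by rewrite (eq_finite_set eqC); exact: infinite_nat.
have cntE : countable (\bigcup_(i in C) [set j | ~ S i j]).
  by apply: bigcup_countable => // i /CD/cofS/finite_set_countable.
have [d Dd Cd] : exists2 d, D d & forall i, C i -> S i d.
  apply: contrapT => nod; apply: uncD; apply: sub_countable cntE.
  apply: subset_card_le => d Dd; apply: contrapT => Ed; apply: nod.
  by exists d => // i Ci; apply: contrapT => nS; apply: Ed; exists i.
by apply: infC; apply: sub_finite_set (cofS d Dd) => i /Cd/asymS.
Qed.

(** Totality makes the strict relation asymmetric, and closedness makes it open,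
    so that it passes from the limit [z] to cofinitely many [x j]. *)
Lemma strict_side_countable {X : topologicalType} {I : Type} {x : I -> X}
    {z : X} {T : set (X * X)} :
  x @ (@frechet_filter I : set_system I) --> z ->
  T `|` T^-1%relation = [set: X * X] -> closed T ->
  countable [set i | ~ T (z, x i)].
Proof.
move=> xz totT clT.
apply: (@asymmetric_cofinite_countable _ (fun i j => ~ T (x j, x i))).
  move=> i j nTji nTij.
  have : (T `|` T^-1%relation) (x i, x j) by rewrite totT.
  by case.
move=> i /= nTzi; have cT : closed [set w | T (w, x i)].
  apply: (@preimage_closed _ _ (fun w => (w, x i))) => // w _.
  by apply: cvg_pair; [exact: cvg_id|exact: cvg_cst].
have nzi : nbhs z (~` [set w | T (w, x i)]).
  by apply: open_nbhs_nbhs; split; [exact: closed_openC|].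
exact: xz nzi.
Qed.

Lemma tournament_cvg_cofinite_countable {X : topologicalType} {I : Type}
    {x : I -> X} {z : X} {T : set (X * X)} :
  x @ (@frechet_filter I : set_system I) --> z -> topological_tournament T ->
  (forall i, x i <> z) -> countable [set: I].
Proof.
move=> xz [[_ antiT totT] clT] neq_xz.
(* The other side of [z] is handled by reversing the tournament. *)
have clV : closed (T^-1%relation : set (X * X)).
  apply: (@preimage_closed _ _ (fun p : X * X => (p.2, p.1))) => // p _.
  by apply: cvg_pair; [exact: cvg_snd|exact: cvg_fst].
have cntT := strict_side_countable xz totT clT.
have totV : T^-1%relation `|` T^-1%relation^-1%relation = [set: X * X].
  by rewrite setUC -totT; congr setU; apply/seteqP; split=> -[].
have cntV := strict_side_countable xz totV clV.
apply: sub_countable (bigcup_countable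
  (F := fun b : bool => if b then [set i | ~ T (z, x i)]
                        else [set i | ~ T (x i, z)])
  (countableP [set: bool]) _); last by case.
apply: subset_card_le => i _.
have [Tzi|nTzi] := pselect (T (z, x i)); last by exists true.
exists false => //= Tiz; apply: (neq_xz i).
by have : (T `&` T^-1%relation) (x i, z) by []; rewrite antiT.
Qed.

Lemma cvg_change_coordinate {I : Type} {Y : topologicalType} (y1 y2 : Y) :
  infinite_set [set: I] ->
  (fun i => (fun k => if pselect (k = i) then y2 else y1) : {ptws I -> Y})
    @ (@frechet_filter I : set_system I) --> ((fun=> y1) : {ptws I -> Y}).
Proof.
move=> /frechet_properfilter FF; apply/cvg_sup => k A.
rewrite nbhsE => -[_ [[B oB <-] By1] BA].
(* The [k]-th coordinate differs from [y1] at the index [k] only. *)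
apply: sub_finite_set (finite_set1 k) => i nAi.
apply: contrapT => neq_ik; apply: nAi; apply: BA.
by rewrite /=; case: pselect => // eq_ki; case: neq_ik.
Qed.

Lemma uncountable_real (R : realType) : ~ countable [set: R].
Proof.
move=> /countable_lebesgue_measure0.
by rewrite -(@set_itvNyy _ R) lebesgue_measure_itv.
Qed.

Theorem theorem8p3 (R : realType) (Y : topologicalType) (I : Type)
    (Y_compact : compact [set: Y]) (Y_hausdorff : hausdorff_space Y)
    (Y_gt1 : exists y1 y2 : Y, y1 <> y2)
    (I_ge_continuum : [set: R] #<= [set: I]) :
  ~ exists T : set ({ptws I -> Y} * {ptws I -> Y}), topological_tournament T.
Proof.
move=> [T tT]; have [y1 [y2 neq_y12]] := Y_gt1.
have uncI : ~ countable [set: I].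
  by move=> /(sub_countable I_ge_continuum); exact: uncountable_real.
have infI : infinite_set [set: I] by move=> /finite_set_countable.
apply: uncI; apply: (tournament_cvg_cofinite_countable
  (@cvg_change_coordinate I Y y1 y2 infI) tT) => i.
by move=> /(congr1 (fun f => f i)); case: pselect => // _ /esym.
Qed.
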